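(* Let $G$ and $H$ be graphs, each with at least one vertex. Then the join $G\nabla H$ is a square if and only if at least one of $G,H$ either is a square, or is not connected and has two isomorphic connected components.
   Context: The join $G\nabla H$ has vertex set $V(G)\sqcup V(H)$ and edge set $E(G)\cup E(H)\cup\{gh: g\in V(G),h\in V(H)\}$. All graphs are finite and simple. A partially labeled graph is a graph $K$ together with an injective map $\theta: L\to V(K)$, $L\subseteq\mathbb{N}$, whose image $\theta(L)$ is nonempty and a proper subset of $V(K)$; vertices in $\theta(L)$ are labeled. The square $KK$ is obtained from two disjoint copies of $K$ by identifying each labeled vertex $\theta(\ell)$ of the first copy with $\theta(\ell)$ of the second copy (keeping all edges, merging double edges). A graph is a square if it is isomorphic to $KK$ for some partially labeled graph $K$. *)

(* Defs.v *)
From HB Require Import structures.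
From mathcomp Require Import all_boot finmap.

Set Implicit Arguments.
Unset Strict Implicit.
Unset Printing Implicit Defensive.

Record sgraph := SGraph {
  vertex :> finType;
  adj : rel vertex;
  adj_sym : symmetric adj;
  adj_irr : irreflexive adj
}.
Arguments adj {s}.

Definition graph_iso (G H : sgraph) : Prop :=
  exists2 f : G -> H, bijective f & {mono f : x y / adj x y}.

Section Join.
Variables G H : sgraph.

Definition join_adj (x y : G + H) : bool :=
  match x, y with
  | inl g, inl g' => adj g g'
  | inr h, inr h' => adj h h'
  | _, _ => true
  end.

Lemma join_adj_sym : symmetric join_adj.
Proof. by case=> x [] y //=; apply: adj_sym. Qed.

Lemma join_adj_irr : irreflexive join_adj.
Proof. by case=> x /=; apply: adj_irr. Qed.

Definition graph_join : sgraph := SGraph join_adj_sym join_adj_irr.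
End Join.

Section Induced.
Variables (G : sgraph) (A : {set G}).

Definition induced_adj : rel {x : G | x \in A} :=
  fun x y => adj (val x) (val y).

Lemma induced_adj_sym : symmetric induced_adj.
Proof. by move=> x y; apply: adj_sym. Qed.

Lemma induced_adj_irr : irreflexive induced_adj.
Proof. by move=> x; apply: adj_irr. Qed.

Definition induced : sgraph := SGraph induced_adj_sym induced_adj_irr.
End Induced.

(* The empty graph counts as connected here. *)
Definition graph_connected (G : sgraph) : Prop :=
  forall x y : G, connect adj x y.

Definition components (G : sgraph) : {set {set G}} :=
  equivalence_partition (connect adj) [set: G].

Definition two_iso_components (G : sgraph) : Prop :=
  exists C D : {set G},
    [/\ C \in components G, D \in components G, C != D &
        graph_iso (induced C) (induced D)].

(* Finiteness of the label set is no restriction, since the labelling is an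
   injection into a finite type. *)
Record plgraph := PLGraph {
  plg_graph :> sgraph;
  plg_labels : {fset nat};
  plg_theta : plg_labels -> plg_graph;
  plg_inj : injective plg_theta;
  plg_nonempty : [set plg_theta l | l : plg_labels] != set0;
  plg_proper : [set plg_theta l | l : plg_labels] \proper [set: plg_graph]
}.

(* The square is the quotient of the disjoint union K + K by [glue]; its
   vertices are the equivalence classes, and two classes are adjacent when some
   representatives are adjacent in K + K. *)
Section Square.
Variable K : plgraph.

Definition dunion_adj (x y : K + K) : bool :=
  match x, y with
  | inl u, inl v | inr u, inr v => adj u v
  | _, _ => false
  end.

Definition glue (x y : K + K) : bool :=
  [|| x == y,
      [exists l, (x == inl (plg_theta l)) && (y == inr (plg_theta l))] |
      [exists l, (x == inr (plg_theta l)) && (y == inl (plg_theta l))]].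

Lemma glue_equiv : {in [set: K + K] & &, equivalence_rel glue}.
Proof.
have sym x y : glue x y -> glue y x.
  case/or3P=> [/eqP-> | /existsP[l /andP[hx hy]] | /existsP[l /andP[hx hy]]].
  - by rewrite /glue eqxx.
  - by apply/or3P/Or33/existsP; exists l; rewrite hx hy.
  - by apply/or3P/Or32/existsP; exists l; rewrite hx hy.
have trans x y z : glue x y -> glue y z -> glue x z.
  case/or3P=> [/eqP-> // | /existsP[l /andP[/eqP-> /eqP->]]
                         | /existsP[l /andP[/eqP-> /eqP->]]];
  case/or3P=> [/eqP<- | /existsP[m /andP[/eqP e /eqP->]]
                      | /existsP[m /andP[/eqP e /eqP->]]] //.
  - by apply/or3P/Or32/existsP; exists l; rewrite !eqxx.
  - by case: e => ->; rewrite /glue eqxx.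
  - by apply/or3P/Or33/existsP; exists l; rewrite !eqxx.
  - by case: e => ->; rewrite /glue eqxx.
move=> x y z _ _ _; split; first by rewrite /glue eqxx.
by move=> xy; apply/idP/idP; apply: trans => //; apply: sym.
Qed.

Definition square_vertex : finType :=
  {A : {set K + K} | A \in equivalence_partition glue [set: K + K]}.

Definition square_adj : rel square_vertex :=
  fun A B => [exists x in val A, exists y in val B, dunion_adj x y].

Lemma square_adj_sym : symmetric square_adj.
Proof.
suff h A B : square_adj A B -> square_adj B A by move=> A B; apply/idP/idP; apply: h.
case/existsP=> x /andP[xA /existsP[y /andP[yB xy]]].
apply/existsP; exists y; rewrite yB; apply/existsP; exists x; rewrite xA /=.
by move: xy; case: x {xA} => u; case: y {yB} => v //=; rewrite adj_sym.
Qed.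

Lemma square_adj_irr : irreflexive square_adj.
Proof.
case=> A Ap; apply/negbTE/negP.
case/existsP=> x /andP[/= xA /existsP[y /andP[/= yA xy]]].
have: glue x y.
  case/imsetP: Ap => a _ eA; move: xA yA; rewrite eA !inE /= => ax ay.
  by have [_ /(_ ax) <-] := glue_equiv (in_setT a) (in_setT x) (in_setT y).
case/or3P=> [/eqP e | /existsP[l /andP[/eqP ex /eqP ey]]
                    | /existsP[l /andP[/eqP ex /eqP ey]]].
- by move: xy; rewrite e; case: (y) => v /=; rewrite adj_irr.
- by move: xy; rewrite ex ey.
- by move: xy; rewrite ex ey.
Qed.

Definition square : sgraph := SGraph square_adj_sym square_adj_irr.
End Square.

Definition is_square (G : sgraph) : Prop :=
  exists K : plgraph, graph_iso G (square K).

(* Main.v *)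
Require Import Defs.
From mathcomp Require Import all_boot finmap.

Set Implicit Arguments.
Unset Strict Implicit.
Unset Printing Implicit Defensive.

(** A graph is a square exactly when it has a "mirror" with a fixed vertex: an
    involutive automorphism [s] and a nonempty set [A], disjoint from and
    nonadjacent to [s A], such that [s] fixes every vertex outside [A] and
    [s A].  A mirror without fixed vertex splits the graph into two isomorphic
    nonadjacent halves, so it exchanges two isomorphic components; conversely
    two isomorphic components give a mirror exchanging them.  A mirror of [G]
    extends by the identity to the join of [G] and [H], where the vertices of
    [H] are fixed.  Finally, since every vertex of [G] is adjacent to every
    vertex of [H], in a mirror of the join the nonadjacent sets [A] and [s A]
    must lie on the same side, and the mirror restricts to that side. *)

Record mirror (G : sgraph) (s : G -> G) (A : {set G}) : Prop := Mirror {
  mirror_inv : involutive s;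
  mirror_homo : {homo s : x y / adj x y};
  mirror_disj : {in A, forall x, s x \notin A};
  mirror_fix : forall x, x \notin A -> s x \notin A -> s x = x;
  mirror_nadj : {in A &, forall x y, ~~ adj x (s y)};
  mirror_neq0 : exists x, x \in A
}.

Definition has_mirror (G : sgraph) : Prop := exists s A, @mirror G s A.

Definition has_fixing_mirror (G : sgraph) : Prop :=
  exists s A, @mirror G s A /\ exists x, s x = x.

Lemma mirror_mono (G : sgraph) (s : G -> G) (A : {set G}) :
  mirror s A -> {mono s : x y / adj x y}.
Proof.
move=> m x y; apply/idP/idP; last exact: mirror_homo m _ _.
by move=> /(mirror_homo m); rewrite !(mirror_inv m).
Qed.

(** Used to carry a mirror from [square K] to an isomorphic graph, and from a join to the join with
    its sides exchanged. *)
Lemma mirror_iso (G H : sgraph) (s : H -> H) (A : {set H}) (f : G -> H) g :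
  cancel f g -> cancel g f -> {mono f : x y / adj x y} ->
  mirror s A -> mirror (g \o s \o f) (f @^-1: A).
Proof.
move=> fK gK fadj m; split=> /=.
- by move=> x /=; rewrite gK (mirror_inv m) fK.
- by move=> x y /= xy; rewrite -fadj !gK (mirror_mono m) fadj.
- by move=> x; rewrite !inE /= gK => /(mirror_disj m).
- by move=> x; rewrite !inE /= gK => xA sxA; rewrite (mirror_fix m) ?fK.
- by move=> x y; rewrite !inE => xA yA; rewrite -fadj /= gK (mirror_nadj m).
- by have [x xA] := mirror_neq0 m; exists (g x); rewrite inE gK.
Qed.

Definition swap_sum (S T : Type) (x : S + T) : T + S :=
  match x with inl u => inr u | inr u => inl u end.
Arguments swap_sum {S T}.

Lemma swap_sumK (S T : Type) : cancel (@swap_sum S T) (@swap_sum T S).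
Proof. by case. Qed.

(** * The canonical mirror of a square *)

Section SquareMirror.
Variable K : plgraph.
Implicit Types (x y z : K + K) (V W : square K).

Lemma glue_refl x : glue x x.
Proof. by rewrite /glue eqxx. Qed.

Lemma glue_eq x y : glue x y -> glue x =1 glue y.
Proof. by move=> xy z; have [_ ->] := glue_equiv (in_setT x) (in_setT y) (in_setT z). Qed.

Lemma glue_sym x y : glue x y = glue y x.
Proof. by apply/idP/idP => /glue_eq <-; apply: glue_refl. Qed.

Lemma square_class_proof x :
  [set y in [set: K + K] | glue x y] \in equivalence_partition (@glue K) setT.
Proof. exact: imset_f. Qed.

Definition square_class x : square K :=
  exist (fun B => is_true (B \in equivalence_partition (@glue K) setT)) _
    (square_class_proof x).

Lemma in_square_class x y : (y \in val (square_class x)) = glue x y.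
Proof. by rewrite !inE. Qed.

Lemma square_classP V : exists x, V = square_class x.
Proof.
case: V => V VP; have /imsetP [x _ eV] := VP.
by exists x; apply: val_inj.
Qed.

Lemma square_class_eq x y : glue x y -> square_class x = square_class y.
Proof.
move=> xy; apply: val_inj; apply/setP => z.
by rewrite !in_square_class (glue_eq xy).
Qed.

Lemma glue_inl_inr (u v : K) :
  glue (inl u : K + K) (inr v) -> exists2 l, u = plg_theta l & v = plg_theta l.
Proof.
case/or3P => [//|/existsP [l /andP [/eqP [->] /eqP [->]]]|/existsP [l /andP[]//]].
by exists l.
Qed.

Lemma glue_swap x y : glue (swap_sum x) (swap_sum y) = glue x y.
Proof.
suff h (a b : K + K) : glue a b -> glue (swap_sum a) (swap_sum b).
  by apply/idP/idP => /h; rewrite ?swap_sumK.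
case/or3P => [/eqP ->|/existsP [l /andP [/eqP -> /eqP ->]]
   |/existsP [l /andP [/eqP -> /eqP ->]]]; first exact: glue_refl.
- by apply/or3P/Or33/existsP; exists l; rewrite !eqxx.
- by apply/or3P/Or32/existsP; exists l; rewrite !eqxx.
Qed.

Lemma swap_square_proof V :
  swap_sum @: val V \in equivalence_partition (@glue K) setT.
Proof.
have [x ->] := square_classP V.
rewrite (_ : _ @: _ = val (square_class (swap_sum x))).
  exact: square_class_proof.
apply/setP => y; rewrite in_square_class -[y in LHS]swap_sumK.
rewrite mem_imset; last exact: can_inj (@swap_sumK _ _).
by rewrite in_square_class -glue_swap swap_sumK.
Qed.

(** The exchange of the two copies respects [glue], so it sends classes to classes and acts on the
    square. *)
Definition swap_square V : square K :=
  exist (fun B => is_true (B \in equivalence_partition (@glue K) setT)) _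
    (swap_square_proof V).

Lemma in_swap_square V x : (x \in val (swap_square V)) = (swap_sum x \in val V).
Proof.
rewrite -[x in LHS]swap_sumK mem_imset //; exact: can_inj (@swap_sumK _ _).
Qed.

(** These are the unlabeled vertices of the first copy: the class of a labeled vertex also meets the
    second copy. *)
Definition left_classes : {set square K} :=
  [set V : square K | [forall x in val V, is_inl x]].

Lemma left_classesP V :
  reflect (forall x, x \in val V -> is_inl x) (V \in left_classes).
Proof. by rewrite inE; apply: (iffP forall_inP). Qed.

Lemma mem_square V W x : x \in val V -> x \in val W -> V = W.
Proof.
have [a ->] := square_classP V; have [b ->] := square_classP W.
rewrite !in_square_class => ax bx.
by rewrite (square_class_eq ax) (square_class_eq bx).
Qed.

Lemma square_mirror : mirror swap_square left_classes.
Proof.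
split.
- move=> V; apply: val_inj; apply/setP => x.
  by rewrite !in_swap_square swap_sumK.
- move=> V W /existsP [x /andP [xV /existsP [y /andP [yW xy]]]].
  apply/existsP; exists (swap_sum x); rewrite in_swap_square swap_sumK xV.
  apply/existsP; exists (swap_sum y); rewrite in_swap_square swap_sumK yW /=.
  by case: x y xy {xV yW} => u [] v.
- move=> V; have [x ->] := square_classP V => /left_classesP lV.
  have xV : x \in val (square_class x) by rewrite in_square_class glue_refl.
  apply/negP => /left_classesP /(_ (swap_sum x)).
  rewrite in_swap_square swap_sumK xV => /(_ isT).
  by case: (x) (lV _ xV).
(* A class outside both halves contains some [inl v] and some [inr u]. These are glued, so [u] and
   [v] are the same labeled vertex, and the exchange fixes the class. *)
- move=> V; rewrite [V \in _]inE [_ V \in _]inE => /forall_inPn [x xV lx].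
  move=> /forall_inPn [y]; rewrite in_swap_square => yV ly.
  case: x xV lx => // u uV _; case: y yV ly => //= v vV _.
  suff uu : glue (inl v : K + K) (inr u).
    have [l ev eu] := glue_inl_inr uu; apply: (@mem_square _ _ (inr u)) => //.
    by rewrite in_swap_square /= eu -ev.
  have [a eV] := square_classP V; move: uV vV; rewrite eV !in_square_class.
  by move=> au av; rewrite -(glue_eq av).
- move=> V W /left_classesP lV /left_classesP lW.
  apply/negP => /existsP [x /andP [/lV lx /existsP [y /andP []]]].
  by rewrite in_swap_square => /lW; case: x lx => // u _; case: y.
- have /properP [_ [u _ uP]] := plg_proper K.
  exists (square_class (inl u)); apply/left_classesP => -[//|v].
  rewrite in_square_class => /glue_inl_inr [l eu _].
  by case/negP: uP; rewrite eu imset_f.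
Qed.

Lemma square_has_fixing_mirror : has_fixing_mirror (square K).
Proof.
exists swap_square, left_classes; split; first exact: square_mirror.
have /set0Pn [u /imsetP [l _ _]] := plg_nonempty K.
exists (square_class (inl (plg_theta l))).
apply: (@mem_square _ _ (inr (plg_theta l))).
  by rewrite in_swap_square in_square_class glue_refl.
rewrite in_square_class; apply/or3P/Or32/existsP; exists l; by rewrite !eqxx.
Qed.

(** Recognizes the quotient: [h] is a surjection whose fibres are the [glue] classes and under which
    the edges of [G] are exactly the images of edges of [K + K]. A section of [h] then induces the
    isomorphism. *)
Lemma graph_iso_square (G : sgraph) (h : K + K -> G) :
  (forall x y, (h x == h y) = glue x y) ->
  (forall x y, dunion_adj x y -> adj (h x) (h y)) ->
  (forall a, exists x, h x = a) ->
  (forall a b, adj a b -> exists x y, [/\ h x = a, h y = b & dunion_adj x y]) ->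
  graph_iso G (square K).
Proof.
move=> hglue hadj /fin_all_exists [s hs] adjh.
have /fin_all_exists [r hr] := @square_classP.
have rV V : r V \in val V by rewrite [V in val V]hr in_square_class glue_refl.
exists (square_class \o s).
- exists (h \o r) => [a|V] /=.
    by rewrite -[RHS]hs; apply/eqP; rewrite hglue glue_sym -in_square_class rV.
  by rewrite [RHS]hr; apply: square_class_eq; rewrite -hglue hs.
- move=> a b; apply/idP/idP => /=.
    case/existsP => x /andP [+ /existsP [y /andP []]].
    by rewrite !in_square_class -!hglue !hs => /eqP -> /eqP -> /hadj.
  move=> /adjh [x [y [ex ey xy]]]; apply/existsP; exists x.
  rewrite in_square_class -hglue hs ex eqxx; apply/existsP; exists y.
  by rewrite in_square_class -hglue hs ey eqxx.
Qed.

End SquareMirror.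

(** * From a fixing mirror to a square *)

(** The labels are the ranks 0, ..., #|S| - 1 in the enumeration of [S]. *)
Lemma set_labelling (T : finType) (S : {set T}) :
  exists (L : {fset nat}) (theta : L -> T),
    injective theta /\ [set theta l | l : L] = S.
Proof.
pose L : {fset nat} := seq_fset tt (iota 0 #|S|).
have /fin_all_exists [r hr] : forall l : L, exists i : 'I_#|S|, val i = val l.
  move=> l; have := valP l; rewrite seq_fsetE mem_iota /= => lS.
  by exists (Ordinal lS).
exists L, (fun l => enum_val (r l)); split.
  by move=> l m /enum_val_inj /(congr1 val); rewrite !hr => /val_inj.
apply/setP => x; apply/imsetP/idP => [[l _ ->]|xS]; first exact: enum_valP.
have iL : val (enum_rank_in xS x) \in L by rewrite seq_fsetE mem_iota /=.
exists [` iL]%fset => //; rewrite (_ : r _ = enum_rank_in xS x) ?enum_rankK_in //.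
by apply: val_inj; rewrite hr.
Qed.

(** Take for [K] the graph induced on the complement of [s A], with the vertices fixed by [s]
    labeled. The fixed vertex makes the label set nonempty, and a vertex of [A] makes it proper. *)
Lemma fixing_mirror_is_square (G : sgraph) : has_fixing_mirror G -> is_square G.
Proof.
move=> [s [A [m [x0 fx0]]]].
(* Since [s] is an involution, this is the complement of [s A]. *)
pose P := [set x | s x \notin A].
have AP x : x \in A -> x \in P by rewrite inE; apply: mirror_disj m _.
have fixP x : x \in P -> x \notin A -> s x = x.
  by rewrite inE => sxA xA; apply: mirror_fix m _ xA sxA.
have sA x : x \notin P -> s x \in A by rewrite inE negbK.
pose S := [set u : induced P | val u \notin A].
have [L [theta [theta_inj thetaS]]] := set_labelling S.
have S0 : [set theta l | l : L] != set0.
  have x0A : x0 \notin A by apply/negP => x0A; have := mirror_disj m x0A; rewrite fx0 x0A.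
  have x0P : x0 \in P by rewrite inE fx0.
  by rewrite thetaS; apply/set0Pn; exists (Sub x0 x0P); rewrite inE.
have ST : [set theta l | l : L] \proper [set: induced P].
  rewrite thetaS; apply/properP; split; first exact: subsetT.
  have [a aA] := mirror_neq0 m; exists (Sub a (AP _ aA)); by rewrite ?inE ?aA.
pose K := PLGraph theta_inj S0 ST.
have lab (u : K) : val u \notin A -> exists l : plg_labels K, u = plg_theta l.
  move=> uA; have : u \in S by rewrite inE.
  by rewrite -thetaS => /imsetP [l _ ->]; exists l.
have labA (l : plg_labels K) : val (plg_theta l) \notin A.
  have : theta l \in S by rewrite -thetaS imset_f.
  by rewrite inE.
(* The first copy of [K] is placed by inclusion, the second by its reflection under [s]; by [hLR]
   they meet exactly in the labeled vertices. *)
pose h (x : K + K) : G := match x with inl u => val u | inr u => s (val u) end.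
have hLR (u v : K) : (val u == s (val v)) = glue (inl u : K + K) (inr v).
  apply/eqP/idP => [uv|/glue_inl_inr [l -> ->]]; last first.
    by rewrite [in RHS]fixP ?labA //; apply: valP.
  have uA : val u \notin A by rewrite uv; have := valP v; rewrite inE.
  have su := fixP _ (valP u) uA.
  have e : u = v by apply: val_inj; rewrite -su uv (mirror_inv m).
  have [l ul] := lab u uA; apply/or3P/Or32/existsP; exists l.
  by rewrite -e -ul !eqxx.
exists K; apply: (@graph_iso_square K G h).
- move=> [] u [] v /=.
  + apply/eqP/idP => [/val_inj ->|]; first exact: glue_refl.
    by case/or3P => [/eqP [->]|/existsP [l /andP []]|/existsP [l /andP []]].
  + exact: hLR.
  + by rewrite eq_sym hLR glue_sym.
  + apply/eqP/idP => [/(inv_inj (mirror_inv m)) /val_inj ->|]; first exact: glue_refl.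
    by case/or3P => [/eqP [->]|/existsP [l /andP []]|/existsP [l /andP []]].
- by move=> [] u [] v //= uv; rewrite (mirror_mono m).
- move=> a; have [aP|/sA/AP aP] := boolP (a \in P); first by exists (inl (Sub a aP)).
  by exists (inr (Sub (s a) aP)); rewrite /= (mirror_inv m).
(* If [b] is in [s A], its neighbor [a] is not in [A], so [s a] is in [P] and the whole edge lifts
   to the second copy. *)
- have key a b : adj a b -> b \notin P ->
    exists x y, [/\ h x = a, h y = b & dunion_adj x y].
    move=> ab bP; have sbA := sA _ bP.
    have saP : s a \in P.
      rewrite inE (mirror_inv m); apply/negP => aA.
      by have := mirror_nadj m aA sbA; rewrite (mirror_inv m) ab.
    exists (inr (Sub (s a) saP)), (inr (Sub (s b) (AP _ sbA))).
    split; rewrite /= ?(mirror_inv m) //.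
    by rewrite /adj /= /induced_adj /= (mirror_mono m).
  move=> a b ab; have [bP|] := boolP (b \in P); last exact: key.
  have [aP|aP] := boolP (a \in P).
    by exists (inl (Sub a aP)), (inl (Sub b bP)).
  rewrite adj_sym in ab; have [x [y [ex ey xy]]] := key _ _ ab aP.
  exists y, x; split=> //.
  by case: x y xy {ex ey} => u [] v //=; rewrite induced_adj_sym.
Qed.

Lemma is_squareP (G : sgraph) : is_square G <-> has_fixing_mirror G.
Proof.
split; last exact: fixing_mirror_is_square.
move=> [K [f [g fK gK] fadj]].
have [s [A [m [x fx]]]] := square_has_fixing_mirror K.
exists (g \o s \o f), (f @^-1: A); split; first exact: mirror_iso.
by exists (g x); rewrite /= gK fx.
Qed.

(** * Mirrors and isomorphic components *)

Section Components.
Variable G : sgraph.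
Implicit Types (x y : G) (C D : {set G}).

Lemma connect_adj_sym : connect_sym (@adj G).
Proof. exact/sym_connect_sym/adj_sym. Qed.

Lemma componentP C x : C \in components G -> x \in C -> C = [set y | connect adj x y].
Proof.
move=> /imsetP [a _ ->]; rewrite !inE /= => ax.
by apply/setP => y; rewrite !inE /= (same_connect connect_adj_sym ax).
Qed.

Lemma component_closed C : C \in components G -> closed (@adj G) C.
Proof.
move=> CP; apply: (intro_closed connect_adj_sym) => x y xy xC.
by rewrite (componentP CP xC) inE connect1.
Qed.

Lemma component_mem C : C \in components G -> exists x, x \in C.
Proof. by move=> /imsetP [a _ ->]; exists a; rewrite !inE /= connect0. Qed.

(** The mirror is the isomorphism on [C], its inverse on [D] and the identity elsewhere, with [C] as
    the set [A]. Distinct components are disjoint and have no edge between them. *)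
Lemma two_iso_components_has_mirror : two_iso_components G -> has_mirror G.
Proof.
move=> [C [D [CP DP CD [f [g fK gK] fadj]]]].
have dis x : x \in C -> x \notin D.
  move=> xC; apply: contraNN CD => xD.
  by rewrite (componentP CP xC) -(componentP DP xD).
have vadj (u v : induced C) :
  adj (val (f u)) (val (f v)) = adj (val u) (val v) := fadj u v.
(* The first [insub] tests membership in [C], the second in [D]. *)
pose s x : G :=
  if insub x is Some u then val (f u)
  else if insub x is Some v then val (g v) else x.
have sC (u : induced C) : s (val u) = val (f u) by rewrite /s valK.
have sD (v : induced D) : s (val v) = val (g v).
  rewrite /s insubF ?valK //; apply/negbTE; apply: contraL (valP v); exact: dis.
have sN x : x \notin C -> x \notin D -> s x = x.
  by move=> xC xD; rewrite /s !insubF //; apply: negbTE.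
have sCD x : x \in C -> s x \in D.
  by move=> xC; rewrite (sC (Sub x xC)); apply: valP.
have sDC x : x \in D -> s x \in C.
  by move=> xD; rewrite (sD (Sub x xD)); apply: valP.
exists s, C; split.
- move=> x; have [xC|xC] := boolP (x \in C).
    by rewrite (sC (Sub x xC)) sD fK.
  have [xD|xD] := boolP (x \in D); first by rewrite (sD (Sub x xD)) sC gK.
  by rewrite !sN.
- move=> x y xy.
  have eC := component_closed CP xy; have eD := component_closed DP xy.
  have [xC|xC] := boolP (x \in C).
    have yC : y \in C by rewrite -eC.
    rewrite (sC (Sub x xC)) (sC (Sub y yC)).
    by rewrite vadj.
  have [xD|xD] := boolP (x \in D); last by rewrite !sN // -?eC -?eD.
  have yD : y \in D by rewrite -eD.
  rewrite (sD (Sub x xD)) (sD (Sub y yD)).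
  by rewrite -vadj !gK.
- by move=> x /sCD; apply: contraL; apply: dis.
- move=> x xC sxC; apply: sN => //; apply: contraNN sxC; exact: sDC.
- move=> x y xC /sCD yD; apply/negP => xy.
  by have := dis _ xC; rewrite (component_closed DP xy) yD.
- exact: component_mem.
Qed.

(** Without fixed vertices, [A] and [s A] cover the graph and no edge joins them, so [A] is a union
    of components. For [a] in [A], the components of [a] and [s a] are distinct and [s] exchanges
    them. *)
Lemma fixfree_mirror_components (s : G -> G) (A : {set G}) :
  mirror s A -> (forall x, s x <> x) ->
  ~ graph_connected G /\ two_iso_components G.
Proof.
move=> m nofix; have [a aA] := mirror_neq0 m.
have Acl : closed (@adj G) A.
  apply: (intro_closed connect_adj_sym) => x y xy xA.
  (* A neighbor [y] outside [A] lies in [s A], as it is not fixed; this contradicts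
     [mirror_nadj]. *)
  apply/negPn/negP => yA; have [syA|syA] := boolP (s y \in A).
    by have := mirror_nadj m xA syA; rewrite (mirror_inv m) xy.
  by case: (nofix y); apply: mirror_fix m _ yA syA.
have nconn : ~~ connect adj a (s a).
  by apply/negP => /(closed_connect Acl); rewrite aA (negbTE (mirror_disj m aA)).
split; first by move=> /(_ a (s a)); apply/negP.
have sconn x y : connect adj x y -> connect adj (s x) (s y).
  case/connectP => p; elim: p x => [x _ -> //|z p IHp x /= /andP [xz zp] e].
  exact: connect_trans (connect1 (mirror_homo m xz)) (IHp _ zp e).
pose C x := [set y in [set: G] | connect adj x y].
have CP x : C x \in components G by apply: imset_f.
exists (C a), (C (s a)); split=> //.
  apply/eqP => /setP /(_ (s a)); by rewrite !inE /= connect0 (negbTE nconn).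
have sCC (u : induced (C a)) : s (val u) \in C (s a).
  by have := valP u; rewrite !inE /= => /sconn.
have sCC' (u : induced (C (s a))) : s (val u) \in C a.
  by have := valP u; rewrite !inE /= => /sconn; rewrite (mirror_inv m).
exists (fun u => exist (fun y => is_true (y \in C (s a))) _ (sCC u)).
  by exists (fun u => exist (fun y => is_true (y \in C a)) _ (sCC' u)) => u; apply: val_inj; rewrite /= (mirror_inv m).
by move=> u v; rewrite /adj /= /induced_adj /= (mirror_mono m).
Qed.

(** The two alternatives correspond to whether the mirror fixes a vertex. *)
Lemma has_mirrorP :
  has_mirror G <->
  is_square G \/ (~ graph_connected G /\ two_iso_components G).
Proof.
split; last first.
  move=> [/is_squareP [s [A [m _]]]|[_ /two_iso_components_has_mirror //]].
  by exists s, A.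
move=> [s [A m]]; have [/existsP [x /eqP fx]|nofix] := boolP [exists x, s x == x].
  by left; apply/is_squareP; exists s, A; split=> //; exists x.
right; apply: (fixfree_mirror_components m) => x fx.
by case/existsP: nofix; exists x; apply/eqP.
Qed.

End Components.

(** * Mirrors of a join *)

Section JoinMirror.
Variables G H : sgraph.

Lemma join_has_fixing_mirror :
  0 < #|H| -> has_mirror G -> has_fixing_mirror (graph_join G H).
Proof.
move=> /card_gt0P [y0 _] [s [A m]].
pose t (x : graph_join G H) : graph_join G H :=
  match x with inl g => inl (s g) | inr h => inr h end.
pose B : {set graph_join G H} := inl @: A.
have mem_inl (g : G) : (inl g \in B) = (g \in A).
  by rewrite mem_imset // => a b [].
have mem_inr (h : H) : (inr h \in B) = false.
  by apply/imsetP => -[].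
exists t, B; split; last by exists (inr y0).
split.
- by case=> //= g; rewrite (mirror_inv m).
- by move=> [] x [] y //; apply: mirror_homo m _ _.
- by case=> [g|h]; rewrite ?mem_inr //= !mem_inl; apply: mirror_disj m _.
- by case=> //= g; rewrite !mem_inl => gA sgA; rewrite (mirror_fix m).
- case=> [g|h] [g'|h']; rewrite ?mem_inr // !mem_inl; exact: mirror_nadj m _ _.
- by have [a aA] := mirror_neq0 m; exists (inl a); rewrite mem_inl.
Qed.

Lemma join_mirror_left (s : graph_join G H -> graph_join G H) A (a : G) :
  mirror s A -> inl a \in A -> has_mirror G.
Proof.
move=> m aA.
(* The vertex [a] is adjacent to all of [H] but to nothing in [s A], so [s A] lies in [G]. In turn
   [s a] is in [G] and adjacent to nothing in [A], so [A] lies in [G]. *)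
have sAL x : x \in A -> is_inl (s x).
  by move=> xA; have := mirror_nadj m aA xA; case: (s x).
have AL x : x \in A -> is_inl x.
  move=> xA; have := mirror_nadj m xA aA; have := sAL _ aA.
  by case: (s _) => // g _; case: (x).
(* A vertex of [G] is in [A], in [s A], or fixed; in each case its image stays in [G]. *)
have sL (g : G) : exists g', s (inl g) = inl g'.
  suff : is_inl (s (inl g)) by case: (s _) => // g' _; exists g'.
  have [/sAL //|gA] := boolP (inl g \in A).
  have [/AL //|sgA] := boolP (s (inl g) \in A).
  by rewrite (mirror_fix m gA sgA).
have {sL} /fin_all_exists [t st] := sL.
exists t, [set g | inl g \in A]; split.
- by move=> g; have := mirror_inv m (inl g); rewrite !st => -[].
- by move=> x y xy; have := @mirror_homo _ _ _ m (inl x) (inl y) xy; rewrite !st.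
- by move=> g; rewrite !inE -st => /(mirror_disj m).
- move=> g; rewrite !inE -st => gA sgA.
  by have := mirror_fix m gA sgA; rewrite st => -[].
- move=> x y; rewrite !inE => xA yA.
  by have := mirror_nadj m xA yA; rewrite st.
- by exists a; rewrite inE.
Qed.

Lemma join_swap_mirror (s : graph_join G H -> graph_join G H) A :
  mirror s A ->
  mirror (G := graph_join H G) (@swap_sum G H \o s \o @swap_sum H G)
    (@swap_sum H G @^-1: A).
Proof.
move=> m; apply: mirror_iso m; try exact: swap_sumK.
by move=> [] x [].
Qed.

End JoinMirror.

Lemma fixing_mirror_joinC (G H : sgraph) :
  has_fixing_mirror (graph_join G H) -> has_fixing_mirror (graph_join H G).
Proof.
move=> [s [A [m [x fx]]]]; have m' := join_swap_mirror m.
eexists _, _; split; first exact: m'.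
by exists (swap_sum x); rewrite /= swap_sumK fx.
Qed.

Theorem theorem5p9 (G H : sgraph) (hG : 0 < #|G|) (hH : 0 < #|H|) :
  is_square (graph_join G H) <->
    (is_square G \/ (~ graph_connected G /\ two_iso_components G)) \/
    (is_square H \/ (~ graph_connected H /\ two_iso_components H)).
Proof.
split.
  (* A vertex of [A] decides the side. The fixed vertex may lie on the other side, so only
     [has_mirror] passes to the factor. *)
  move=> /is_squareP [s [A [m _]]]; have [[g gA|h hA]] := mirror_neq0 m.
    by left; apply/has_mirrorP; apply: join_mirror_left m gA.
  right; apply/has_mirrorP.
  by apply: (join_mirror_left (a := h) (join_swap_mirror m)); rewrite inE.
(* The other factor is nonempty and supplies the fixed vertex. *)
move=> [/has_mirrorP mG|/has_mirrorP mH]; apply/is_squareP.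
  exact: join_has_fixing_mirror.
by apply: fixing_mirror_joinC; apply: join_has_fixing_mirror.
Qed.
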